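(* Let $\mathcal{X}$ be Cantor space and let $G \le H(\mathcal{X})$ be a full and flexible group of homeomorphisms of $\mathcal{X}$. Then $\mathrm{Aut}(\mathrm{Aut}(G)) = \mathrm{Aut}(G)$; that is, the canonical homomorphism $\mathrm{Aut}(G) \to \mathrm{Aut}(\mathrm{Aut}(G))$ sending each element to the inner automorphism (conjugation) it induces is an isomorphism.
   Context: $H(\mathcal{X})$ denotes the group of self-homeomorphisms of a topological space $\mathcal{X}$. Functions are written to the right of their arguments. An element $h \in H(\mathcal{X})$ locally agrees with a subgroup $G \le H(\mathcal{X})$ if for every $x \in \mathcal{X}$ there are an open neighbourhood $U$ of $x$ and an element $g \in G$ with $h\restriction_U = g\restriction_U$. The group $G$ is full if every element of $H(\mathcal{X})$ which locally agrees with $G$ is an element of $G$. A group $G$ acting by homeomorphisms on a compact Hausdorff space $\mathcal{X}$ is flexible if for any pair $E_1, E_2$ of proper closed subsets of $\mathcal{X}$ with non-empty interior there is $g \in G$ with $(E_1)g \subseteq E_2$. *)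

(* Defs.v *)
From HB Require Import structures.
From mathcomp Require Import all_boot.
From mathcomp Require Import boolp classical_sets functions topology cantor.

Set Implicit Arguments.
Unset Strict Implicit.
Unset Printing Implicit Defensive.

Local Open Scope classical_set_scope.
Local Open Scope group_scope.

Section HomeoDef.
Variable X : topologicalType.

Record homeo := Homeo {
  homeo_fun :> X -> X;
  homeo_inv : X -> X;
  homeoK : cancel homeo_fun homeo_inv;
  homeoVK : cancel homeo_inv homeo_fun;
  homeo_continuous : continuous homeo_fun;
  homeo_inv_continuous : continuous homeo_inv
}.

Lemma homeoP (f g : homeo) : f =1 g -> f = g.
Proof.
case: f g => f f' fK f'K fc f'c [g g' gK g'K gc g'c] /= /funext fg; subst g.
have eqf' : f' = g' by apply/funext => x; rewrite -{1}(g'K x) fK.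
by subst g'; congr Homeo; exact: Prop_irrelevance.
Qed.

HB.instance Definition _ := gen_eqMixin homeo.
HB.instance Definition _ := gen_choiceMixin homeo.

Definition homeo_one : homeo :=
  @Homeo idfun idfun (fun=> erefl) (fun=> erefl)
    (fun=> cvg_id) (fun=> cvg_id).

Definition homeo_V (f : homeo) : homeo :=
  Homeo (@homeoVK f) (@homeoK f)
    (@homeo_inv_continuous f) (@homeo_continuous f).

(* Functions act on the right: [f * g] is [f] followed by [g]. *)
Definition homeo_mul (f g : homeo) : homeo :=
  @Homeo (g \o f) (homeo_inv f \o homeo_inv g)
    (can_comp (@homeoK g) (@homeoK f))
    (can_comp (@homeoVK f) (@homeoVK g))
    (fun x => continuous_comp
       (homeo_continuous (h:=f) (x:=x)) (homeo_continuous (h:=g) (x:=f x)))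
    (fun x => continuous_comp
       (homeo_inv_continuous (h:=g) (x:=x))
       (homeo_inv_continuous (h:=f) (x:=homeo_inv g x))).

Lemma homeo_mulA : associative homeo_mul.
Proof. by move=> f g h; apply: homeoP. Qed.
Lemma homeo_mul1g : left_id homeo_one homeo_mul.
Proof. by move=> f; apply: homeoP. Qed.
Lemma homeo_mulg1 : right_id homeo_one homeo_mul.
Proof. by move=> f; apply: homeoP. Qed.
Lemma homeo_mulVg : left_inverse homeo_one homeo_V homeo_mul.
Proof. by move=> f; apply: homeoP => x /=; rewrite homeoVK. Qed.
Lemma homeo_mulgV : right_inverse homeo_one homeo_V homeo_mul.
Proof. by move=> f; apply: homeoP => x /=; rewrite homeoK. Qed.

HB.instance Definition _ := isGroup.Build homeo
  homeo_mulA homeo_mul1g homeo_mulg1 homeo_mulVg homeo_mulgV.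

End HomeoDef.

(* A subgroup is a [groupClosed] boolean predicate; since [boolp] is classical,
   every subset closed under the group operations is of this form. *)
Section HomeoGroups.
Variables (X : topologicalType) (G : groupClosed (homeo X)).

Definition locally_agrees (h : homeo X) :=
  forall x : X, exists (U : set X) (g : homeo X),
    [/\ open U, U x, g \in G & forall y, U y -> h y = g y].

Definition full := forall h : homeo X, locally_agrees h -> h \in G.

Definition flexible := forall E1 E2 : set X,
  closed E1 -> E1 <> [set: X] -> E1° !=set0 ->
  closed E2 -> E2 <> [set: X] -> E2° !=set0 ->
  exists2 g : homeo X, g \in G & g @` E1 `<=` E2.

End HomeoGroups.

Section SubgroupType.
Variables (T : groupType) (G : groupClosed T).

Definition subgroup := {x : T | x \in G}.

HB.instance Definition _ := SubChoice.on subgroup.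

Lemma subgroup_closed : group_closed (fun x : T => x \in G).
Proof. by split=> [|x y]; [exact: gpred1 | exact: gpredF]. Qed.

HB.instance Definition _ :=
  SubChoice_isSubGroup.Build T (fun x : T => x \in G) subgroup subgroup_closed.

End SubgroupType.

Section AutDef.
Variable G : groupType.

Record aut := AutOf {
  aut_fun :> G -> G;
  aut_inv : G -> G;
  autK : cancel aut_fun aut_inv;
  autVK : cancel aut_inv aut_fun;
  autM : {morph aut_fun : x y / x * y}
}.

Lemma autP (f g : aut) : f =1 g -> f = g.
Proof.
case: f g => f f' fK f'K fM [g g' gK g'K gM] /= /funext fg; subst g.
have eqf' : f' = g' by apply/funext => x; rewrite -{1}(g'K x) fK.
by subst g'; congr AutOf; exact: Prop_irrelevance.
Qed.

HB.instance Definition _ := gen_eqMixin aut.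
HB.instance Definition _ := gen_choiceMixin aut.

Lemma aut_invM (f : aut) : {morph aut_inv f : x y / x * y}.
Proof. by move=> x y; apply: (canLR (@autK f)); rewrite autM !autVK. Qed.

Lemma aut_compM (f g : aut) : {morph g \o f : x y / x * y}.
Proof. by move=> x y /=; rewrite !autM. Qed.

Definition aut_one : aut :=
  @AutOf idfun idfun (fun=> erefl) (fun=> erefl) (fun _ _ => erefl).

Definition aut_V (f : aut) : aut :=
  AutOf (@autVK f) (@autK f) (@aut_invM f).

(* As for [homeo_mul], [f * g] is [f] followed by [g]. *)
Definition aut_mul (f g : aut) : aut :=
  AutOf (can_comp (@autK g) (@autK f)) (can_comp (@autVK f) (@autVK g))
    (@aut_compM f g).

Lemma aut_mulA : associative aut_mul.
Proof. by move=> f g h; apply: autP. Qed.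
Lemma aut_mul1g : left_id aut_one aut_mul.
Proof. by move=> f; apply: autP. Qed.
Lemma aut_mulg1 : right_id aut_one aut_mul.
Proof. by move=> f; apply: autP. Qed.
Lemma aut_mulVg : left_inverse aut_one aut_V aut_mul.
Proof. by move=> f; apply: autP => x /=; rewrite autVK. Qed.
Lemma aut_mulgV : right_inverse aut_one aut_V aut_mul.
Proof. by move=> f; apply: autP => x /=; rewrite autK. Qed.

HB.instance Definition _ := isGroup.Build aut
  aut_mulA aut_mul1g aut_mulg1 aut_mulVg aut_mulgV.

(* [x ^ a] is [a^-1 * x * a], so [a |-> inner a] is a homomorphism for the
   left-to-right product of automorphisms. *)
Definition inner (a : G) : aut :=
  @AutOf (fun x => x ^ a) (fun x => x ^ a^-1) (conjgK a) (conjgKV a)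
    (fun x y => conjMg x y a).

End AutDef.

(* Main.v *)
Require Import Defs.
From mathcomp Require Import all_boot.
From mathcomp Require Import boolp classical_sets functions topology cantor.

(* Let [A = Aut G]; since [G] is centerless it embeds in [A] as the group of
   inner automorphisms, and by Burnside it suffices to show that this subgroup
   is characteristic in [A].
   The intersection [M] of all nontrivial normal subgroups of [A] is
   characteristic, lies in [Inn G], and, by Higman's commutator trick, contains
   every commutator of elements of [G] supported in a common proper clopen set.
   By an argument of Belk, Elliott and Matucci in their proof of Rubin's
   theorem, the rigid stabilizers in [M] of regular open sets are definable in
   the group [M].  An automorphism [a] of [G] is inner if and only if there are
   elements [m, m'] of [M] and open sets [W, V] covering the space such that
   [a * m^-1] centralizes the rigid stabilizer of [V], acts like [m'] on that of
   [W], and [m' W = W]: fullness glues [m'] on [W] and the identity on [V] to an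
   element of [G].  That [W] and [V] cover the whole space, rather than a dense
   subset of it, is expressed by a compression property, so the condition is
   invariant under the automorphisms of [A]. *)

Set Implicit Arguments.
Unset Strict Implicit.
Unset Printing Implicit Defensive.

Local Open Scope classical_set_scope.
Local Open Scope group_scope.

(** * Formulas in the language of groups *)

Section Definability.
Variables (T : groupType) (M : set T).

(* Algebraic disjointness: implied by disjointness of the supports of [f] and
   [g], and implying disjointness of those of [f] and [g ^+ 12]. *)
Definition alg_disj (f g : T) := forall h, M h -> ~ commute h f ->
  exists f1 f2, [/\ M f1, M f2, commute f1 g, commute f2 g &
    [~ [~ h, f1], f2] <> 1 /\ commute [~ [~ h, f1], f2] g].

(* For [M] as in [rstabE], the elements of [M] supported in the closure of the
   union of the supports of the elements of [F]. *)
Definition rstab (F : set T) : set T := [set k | M k /\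
  forall g, M g -> (forall f, F f -> alg_disj f g) -> commute k (g ^+ 12)].

(* For the rigid stabilizers [S0], [S1] of regular open sets [W], [V]: elements
   of [S1] compress the exterior of [W] into any nonempty open subset of [V].
   They fix all points outside [V], so no point lies outside both [W] and [V],
   not even on the two boundaries. *)
Definition covering (S0 S1 : set T) := (exists y, S1 y /\ y <> 1) /\
  forall y, S1 y -> y <> 1 -> exists g, S1 g /\
    forall k, M k -> (forall r, S0 r -> commute k r) -> rstab [set y] (k ^ g).

(** [F0] and [F1] are arbitrary subsets of [M]: the formula is second order, but isomorphisms carry
    subsets to subsets and so preserve it. *)
Definition loc_inner (a : T) := exists m m' F0 F1,
  [/\ M m, M m', F0 `<=` M, F1 `<=` M &
   [/\ covering (rstab F0) (rstab F1),
       forall k, rstab F1 k -> commute (a * m^-1) k,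
       forall k, rstab F0 k -> commute (a * m^-1 * m'^-1) k &
       forall k, rstab F0 k <-> rstab F0 (k ^ m')]].

End Definability.

Lemma commute_conj1 (T : groupType) (x y : T) : commute x y <-> x ^ y = x.
Proof. by split=> [/commgP/conjg_fixP|/conjg_fixP/commgP]. Qed.

Lemma commR_mull (T : groupType) (d f g : T) :
  commute d g -> [~ d * f, g] = [~ f, g].
Proof.
move=> /commute_sym/commute_conj1 gd.
by rewrite !commgEr conjgM conjVg gd.
Qed.

Lemma sub_imageP (S T : Type) (f : S -> T) (A : set S) (B : set T) :
  B `<=` f @` A -> exists2 A', B = f @` A' & A' `<=` A.
Proof.
move=> BfA; exists (A `&` f @^-1` B); last by move=> x [].
apply/seteqP; split=> [y By|_ [x [Ax Bx] <-]//].
by have [x Ax xy] := BfA _ By; exists x => //; split=> //=; rewrite xy.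
Qed.

(** * Invariance of the formulas under embeddings of groups *)

Section Transport.
Variables (S T : groupType) (phi : S -> T) (M : set S).
Hypotheses (phiM : {morph phi : x y / x * y}) (phi_inj : injective phi).

Lemma morphg1 : phi 1 = 1.
Proof. by apply: (mulgI (phi 1)); rewrite -phiM !mulg1. Qed.

Lemma morphgV : {morph phi : x / x^-1}.
Proof. by move=> x; apply: (mulgI (phi x)); rewrite -phiM !mulgV morphg1. Qed.

Lemma morphgJ : {morph phi : x y / x ^ y}.
Proof. by move=> x y; rewrite !conjgE !phiM morphgV. Qed.

Lemma morphgR : {morph phi : x y / [~ x, y]}.
Proof. by move=> x y; rewrite !commgEl phiM morphgV morphgJ. Qed.

Lemma morphgX n : {morph phi : x / x ^+ n}.
Proof.
by move=> x; elim: n => [|n IHn]; rewrite ?expg0 ?morphg1// !expgS phiM IHn.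
Qed.

Lemma commute_morph x y : commute (phi x) (phi y) = commute x y.
Proof.
by rewrite /commute -!phiM; apply: propext; split=> [/phi_inj|->].
Qed.

Lemma neq1_morph x : (phi x <> 1) = (x <> 1).
Proof.
rewrite -morphg1; apply: propext.
by split=> nx ex; apply: nx; [rewrite ex|exact: phi_inj].
Qed.

Lemma alg_disj_morph f g :
  alg_disj (phi @` M) (phi f) (phi g) = alg_disj M f g.
Proof.
apply: propext; split=> H h.
- move=> Mh hf; have Mph : (phi @` M) (phi h) by exists h.
  case: (H _ Mph); first by rewrite commute_morph.
  move=> _ [_ [[f1 M1 <-] [f2 M2 <-]]].
  by rewrite -!morphgR !commute_morph neq1_morph => ? ? ?; exists f1, f2.
- case=> {}h Mh <-; rewrite commute_morph => /(H _ Mh)[f1 [f2 [M1 M2 ? ? ?]]].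
  exists (phi f1), (phi f2); rewrite -!morphgR !commute_morph neq1_morph.
  by split=> //; exact: imageP.
Qed.

Lemma rstab_morph F : rstab (phi @` M) (phi @` F) = phi @` rstab M F.
Proof.
apply/seteqP; split=> [_ [[k Mk <-] H]|_ [k [Mk H] <-]].
- exists k => //; split=> // g Mg Hg; rewrite -commute_morph morphgX.
  apply: H; first by exists g.
  by move=> _ [f Ff <-]; rewrite alg_disj_morph; exact: Hg.
- split; first by exists k.
  move=> _ [g Mg <-] Hg; rewrite -morphgX commute_morph.
  by apply: H => // f Ff; rewrite -alg_disj_morph; apply: Hg; exists f.
Qed.

Lemma image_morph (A : set S) x : (phi @` A) (phi x) = A x.
Proof. by apply: propext; split=> [[y Ay /phi_inj <-]//|Ax]; exists x. Qed.

Lemma covering_morph S0 S1 :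
  covering (phi @` M) (phi @` S0) (phi @` S1) = covering M S0 S1.
Proof.
apply: propext; split=> -[[y [Sy y1]] H].
- split.
    by case: Sy y1 => z Sz <-; rewrite neq1_morph => z1; exists z.
  move=> z Sz z1; have [||_ [[g Sg <-] Hg]] := H (phi z).
  + by exists z.
  + by rewrite neq1_morph.
  exists g; split=> // k Mk Hk.
  rewrite -image_morph -rstab_morph image_set1 morphgJ; apply: Hg.
    by exists k.
  by move=> _ [r Sr <-]; rewrite commute_morph; exact: Hk.
- split; first by exists (phi y); rewrite neq1_morph; split=> //; exists y.
  move=> _ [z Sz <-]; rewrite neq1_morph => z1.
  have [g [Sg Hg]] := H z Sz z1; exists (phi g); split; first by exists g.
  move=> _ [k Mk <-] Hk; rewrite -morphgJ -image_set1 rstab_morph image_morph.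
  by apply: Hg => // r Sr; rewrite -commute_morph; apply: Hk; exists r.
Qed.

(** Witnesses are sought within [M] and its subsets, so the formula can be moved along embeddings:
    it is applied to [inner], to [val], and to automorphisms of the automorphism group. *)
Lemma loc_inner_morph a : loc_inner (phi @` M) (phi a) = loc_inner M a.
Proof.
apply: propext; split=> [[_ [_ [F0 [F1 [[m Mm <-] [m' Mm' <-]]]]]]|].
- move=> sF0 sF1.
  have [{}F0 -> {}sF0] := sub_imageP sF0.
  have [{}F1 -> {}sF1] := sub_imageP sF1.
  rewrite !rstab_morph covering_morph => -[cov H1 H0 HJ].
  exists m, m', F0, F1; split=> //; split=> //.
  + move=> k Sk; rewrite -commute_morph phiM morphgV.
    by apply: H1; exists k.
  + move=> k Sk; rewrite -commute_morph !phiM !morphgV.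
    by apply: H0; exists k.
  + by move=> k; rewrite -image_morph HJ -morphgJ image_morph.
- move=> [m [m' [F0 [F1 [Mm Mm' sF0 sF1 [cov H1 H0 HJ]]]]]].
  exists (phi m), (phi m'), (phi @` F0), (phi @` F1); split.
  + by exists m.
  + by exists m'.
  + exact: image_subset.
  + exact: image_subset.
  rewrite !rstab_morph covering_morph; split=> //.
  + by move=> _ [k Sk <-]; rewrite -morphgV -phiM commute_morph; exact: H1.
  + by move=> _ [k Sk <-]; rewrite -!morphgV -!phiM commute_morph; exact: H0.
  + move=> k; split=> [[l Sl <-]|[l Sl lk]].
      by rewrite -morphgJ image_morph -HJ.
    (* [k] is not assumed to lie in the image of [phi]; it does because its conjugate by [phi m']
       does. *)
    have -> : k = phi (l ^ m'^-1) by rewrite morphgJ lk morphgV conjgK.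
    by rewrite image_morph HJ conjgKV.
Qed.

End Transport.

(** * Supports, displacement and clopen sets *)

Section Homeomorphisms.
Variable X : topologicalType.
Implicit Types (f g h k : homeo X) (U V : set X) (x : X).

Lemma homeoM f g x : (f * g) x = g (f x). Proof. by []. Qed.

Lemma homeoKV f : cancel f (f^-1)%g. Proof. exact: homeoK. Qed.

Lemma homeoVKV f : cancel (f^-1)%g f. Proof. exact: homeoVK. Qed.

Lemma homeo_inj f : injective f. Proof. exact: can_inj (homeoKV f). Qed.

Lemma homeoJ f g x : (f ^ g) x = g (f (g^-1 x)). Proof. by []. Qed.

Lemma homeo_neq1 f : f <> 1 -> exists x, f x <> x.
Proof.
move=> f1; apply: contrapT => /forallNP nf; apply/f1/homeoP => x.
exact: contrapT (nf x).
Qed.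

Lemma open_homeo f U : open U -> open (f @^-1` U).
Proof. by move=> oU; apply: open_comp => // x _; exact: homeo_continuous. Qed.

Lemma clopen_homeo f U : clopen U -> clopen (f @^-1` U).
Proof. by move=> cU; apply: preimage_clopen => //; exact: homeo_continuous. Qed.

Definition supported f U := forall x, ~ U x -> f x = x.

Lemma supported_stable f U x : supported f U -> U x -> U (f x).
Proof.
move=> fU Ux; apply: contrapT => nU; have /homeo_inj fx := fU _ nU.
by rewrite fx in nU.
Qed.

Lemma supportedV f U : supported f U -> supported f^-1 U.
Proof. by move=> fU x nU; apply: (canLR (homeoKV f)); rewrite fU. Qed.

Lemma supportedM f g U : supported f U -> supported g U -> supported (f * g) U.
Proof. by move=> fU gU x nU; rewrite homeoM fU// gU. Qed.

Lemma supportedX f U n : supported f U -> supported (f ^+ n) U.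
Proof.
by move=> fU; elim: n => // n IHn; rewrite expgS; exact: supportedM.
Qed.

Lemma supportedJ f g U : supported f U -> supported (f ^ g) ((g^-1)%g @^-1` U).
Proof. by move=> fU x nU; rewrite homeoJ fU// homeoVKV. Qed.

Lemma supportedS f U V : U `<=` V -> supported f U -> supported f V.
Proof. by move=> UV fU x nV; apply: fU => /UV. Qed.

Lemma supportedR f g U : supported f U -> supported g U -> supported [~ f, g] U.
Proof.
move=> fU gU; rewrite commgEl conjgE.
by do !apply: supportedM => //; exact: supportedV.
Qed.

Lemma commute_disjoint f g : (forall x, f x <> x -> g x = x) -> commute f g.
Proof.
move=> fg; apply: homeoP => x; rewrite !homeoM.
have [fx|fx] := pselect (f x = x); last first.
  by rewrite (fg _ fx) fg// => /homeo_inj.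
have [gx|gx] := pselect (g x = x); first by rewrite fx gx fx.
rewrite fx; have [->//|fgx] := pselect (f (g x) = g x).
by case: gx; apply/(@homeo_inj g)/fg.
Qed.

Lemma commute_supported f g U :
  supported f U -> supported g (~` U) -> commute f g.
Proof.
move=> fU gU; apply: commute_disjoint => x fx.
by apply: gU => nU; apply/fx/fU.
Qed.

Lemma conjg_supported f g h U : supported f U -> (forall x, U x -> g x = h x) ->
  f ^ g = f ^ h.
Proof.
move=> fU gh; rewrite -(mulgVK h g) conjgM; congr (_ ^ _).
apply/commute_conj1/(commute_supported fU) => x /contrapT Ux.
by rewrite homeoM gh// homeoKV.
Qed.

(** Higman's trick: [[~ h, f]] is [f] times a conjugate of [f^-1] supported in the image of [U]
    under [h]; this conjugate commutes with [g] and drops out of the commutator. *)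
Lemma commR_displaced h f g U : (forall x, U x -> ~ U (h x)) ->
  supported f U -> supported g U -> [~ [~ h, f], g] = [~ f, g].
Proof.
move=> hU fU gU; rewrite [[~ h, f]]commgEr; apply: commR_mull.
apply: commute_sym; apply: commute_supported gU _.
apply: supportedS (supportedJ (supportedV fU)) => x /= Uhx Ux.
by apply: (hU _ Uhx); rewrite homeoVKV.
Qed.

Lemma local_continuous (f : X -> X) :
  (forall x, exists (O : set X) h,
    [/\ open O, O x & forall y, O y -> f y = h y]) ->
  continuous f.
Proof.
move=> loc x; have [O [h [oO Ox fh]]] := loc x.
have nO : nbhs x O by exact: open_nbhs_nbhs.
have fhn : {near x, h =1 f} by near=> y; rewrite fh//; near: y.
apply: cvg_trans (near_eq_cvg fhn) _.
rewrite (fh x Ox); exact: homeo_continuous.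
Unshelve. all: by end_near.
Qed.

Hypothesis cantorX : cantor_like X.

Lemma clopen_base x U : open U -> U x ->
  exists C, [/\ clopen C, C x & C `<=` U].
Proof.
move=> oU Ux; have [_ cX hX zX] := cantorX.
have [|C [Cx cC] CU] := @zero_dimensional_cvg _ x hX zX cX U.
  exact: open_nbhs_nbhs.
by exists C.
Qed.

Lemma clopen_split x U : open U -> U x ->
  exists C y, [/\ clopen C, C x, C `<=` U, U y & ~ C y].
Proof.
move=> oU Ux; have [[_ pX] _ _ zX] := cantorX.
have : limit_point setT x by rewrite pX.
move=> /(_ U)[|y [yx _ Uy]]; first exact: open_nbhs_nbhs.
have [|V [[oV cV] Vx Vy]] := zX x y; first by rewrite eq_sym.
have [|//|C [cC Cx CUV]] := @clopen_base x (U `&` V); first exact: openI.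
by exists C, y; split=> // [z /CUV[]//|/CUV[]].
Qed.

Lemma clopen_displaced h x U : open U -> U x -> h x <> x ->
  exists C, [/\ clopen C, C x, C `<=` U & forall y, C y -> ~ C (h y)].
Proof.
move=> oU Ux /eqP hx; have [_ _ _ zX] := cantorX.
have [|V [cV Vx Vhx]] := zX x (h x); first by rewrite eq_sym.
have [||C [cC Cx CU]] := @clopen_base x (U `&` (V `&` h @^-1` (~` V))).
- apply: openI => //; apply: openI; first by case: cV.
  by apply: open_homeo; have [] := clopenC V cV.
- by split.
exists C; split=> // [y /CU[]//|y /CU[_ [_ nV]] /CU[_ []//]].
Qed.

Lemma open_moved h : open [set x | h x <> x].
Proof.
rewrite openE => x hx; rewrite /interior /= nbhsE.
have [C [cC Cx _ hC]] := clopen_displaced openT I hx.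
exists C; first by split=> //; case: cC.
by move=> z Cz /= hz; have := hC _ Cz; rewrite hz.
Qed.

End Homeomorphisms.

(** * Gluing and compression in full flexible groups *)

Section FullFlexible.
Variables (X : topologicalType) (G : groupClosed (homeo X)).
Hypotheses (cantorX : cantor_like X) (fullG : full G) (flexG : flexible G).
Implicit Types (f g h k m : homeo X) (E O U V Q Y Z : set X) (x : X).

Lemma flexible_clopen E Y : clopen E -> clopen Y ->
  (exists x, ~ E x) -> (exists y, Y y) ->
  exists2 g, g \in G & forall x, E x -> Y (g x).
Proof.
move=> [oE cE] [oY _] [x0 nEx0] [y Yy].
have [[x Ex]|nE] := pselect (exists x, E x); last first.
  by exists 1; [exact: gpred1|move=> x Ex; case: nE; exists x].
(* Flexibility asks for a proper target, while [Y] may be the whole space; hence the smaller set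
   [C], which misses [z]. *)
have [C [z [[oC cC] Cy CY Yz nCz]]] := clopen_split cantorX oY Yy.
have [|||||g Gg gEC] := flexG cE (E2 := C) => //.
- by move=> ET; apply: nEx0; rewrite ET.
- by exists x; rewrite (interior_id E).1.
- by move=> CT; apply: nCz; rewrite CT.
- by exists y; rewrite (interior_id C).1.
by exists g => // w Ew; apply/CY/gEC; exists w.
Qed.

Definition agrees_locally (f : X -> X) := forall x, exists O g,
  [/\ open O, O x, g \in G & forall y, O y -> f y = g y].

Lemma full_glue (f f' : X -> X) : cancel f f' -> cancel f' f ->
  agrees_locally f -> agrees_locally f' -> exists2 h, h \in G & h =1 f.
Proof.
move=> fK f'K lf lf'.
have ctn (u : X -> X) : agrees_locally u -> continuous u.
  move=> lu; apply: local_continuous => x.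
  by have [O [g [oO Ox _ ug]]] := lu x; exists O, g.
by exists (Homeo fK f'K (ctn _ lf) (ctn _ lf')) => //; exact: fullG.
Qed.

(** Fullness glues [g] on [U], its inverse on the image of [U] and the identity elsewhere into an
    involution. *)
Lemma full_swap g U : g \in G -> clopen U -> (forall x, U x -> ~ U (g x)) ->
  exists2 s, s \in G & [/\ forall x, U x -> s x = g x,
    forall x, U x -> s (g x) = x &
    forall x, ~ U x -> ~ U (g^-1 x) -> s x = x].
Proof.
move=> Gg cU gU.
pose s x := if pselect (U x) then g x
            else if pselect (U (g^-1 x)) then g^-1 x else x.
have s1 x : U x -> s x = g x by rewrite /s; case: pselect.
have s2 x : ~ U x -> U (g^-1 x) -> s x = g^-1 x.
  by rewrite /s; case: pselect => //; case: pselect.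
have s3 x : ~ U x -> ~ U (g^-1 x) -> s x = x.
  by rewrite /s; case: pselect => //; case: pselect.
have sK : cancel s s.
  move=> x; have [Ux|nUx] := pselect (U x).
    by rewrite (s1 x)// s2 ?homeoKV//; exact: gU.
  have [Ugx|nUgx] := pselect (U (g^-1 x)); last by rewrite (s3 x)// s3.
  by rewrite (s2 x)// s1// homeoVKV.
have ls : agrees_locally s.
  move=> x; have [Ux|nUx] := pselect (U x).
    by exists U, g; split=> //; case: cU.
  have cgU := clopen_homeo g^-1 cU.
  have [Ugx|nUgx] := pselect (U (g^-1 x)).
    exists ((g^-1)%g @^-1` U), g^-1; split=> //; first by case: cgU.
      exact: gpredVr.
    by move=> y Uy; apply: s2 => //; rewrite -(homeoVKV g y); exact: gU.
  exists (~` U `&` ~` ((g^-1)%g @^-1` U)), 1; split=> //.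
  - by apply: openI; [have [] := clopenC U cU|have [] := clopenC U cgU].
  - exact: gpred1.
  - by move=> y [nU nUg]; rewrite s3.
have [h Gh hs] := full_glue sK sK ls ls.
exists h => //; split=> x; rewrite hs; [exact: s1| |exact: s3].
by move=> Ux; rewrite s2 ?homeoKV//; exact: gU.
Qed.

Variable M : set (homeo X).
Hypothesis MG : forall g, M g -> g \in G.
Hypothesis M1 : M 1.
Hypothesis MM : forall f g, M f -> M g -> M (f * g).
Hypothesis MJ : forall f g, M f -> g \in G -> M (f ^ g).
(** Everything nontrivial known to lie in [M] comes from these commutators. The hypotheses on [M]
    are later met by [G] itself and by the core of Aut(G) pulled back to [G]. *)
Hypothesis MR : forall E f g, clopen E -> (exists x, ~ E x) ->
  f \in G -> g \in G -> supported f E -> supported g E -> M [~ f, g].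

(** * Rigid stabilizers: transport, compression and noncommuting elements *)

Definition rist U : set (homeo X) := [set m | M m /\ supported m U].

(** Flexibility gives [g] sending [U] into the room in [Z] left free by [U] and its image under [h].
    With [s] exchanging [U] and its [g]-image and [t] exchanging [U] and its [h]-image, [[~ s, t]]
    takes [x] in [U] to [g x], back to [x], then to [h x]. *)
Lemma rist_transport h U Z : h \in G -> clopen U -> clopen Z ->
  (forall x, U x -> [/\ Z x, Z (h x) & ~ U (h x)]) ->
  (exists z, ~ Z z) -> (exists w, [/\ Z w, ~ U w & ~ U (h^-1 w)]) ->
  exists2 m, rist Z m & forall x, U x -> m x = h x.
Proof.
move=> Gh cU cZ hUZ [z nZz] [w [Zw nUw nUhw]].
pose W := Z `&` (~` U `&` ~` ((h^-1)%g @^-1` U)).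
have cW : clopen W.
  apply: clopenI => //; apply: clopenI; apply: clopenC => //.
  exact: clopen_homeo.
have [||g Gg gUW] := flexible_clopen cU cW.
- by exists z => /hUZ[].
- by exists w.
have [|s Gs [s1 s2 s3]] := full_swap Gg cU; first by move=> x /gUW[_ []].
have [|t Gt [t1 t2 t3]] := full_swap Gh cU; first by move=> x /hUZ[].
have stZ (k u : homeo X) : (forall x, U x -> Z (k x)) ->
    (forall x, ~ U x -> ~ U (k^-1 x) -> u x = x) -> supported u Z.
  move=> kZ u3 x nZx; apply: u3 => [/hUZ[]//|/kZ].
  by rewrite homeoVKV.
have sZ : supported s Z by apply: (stZ g) => // x /gUW[].
have tZ : supported t Z by apply: (stZ h) => // x /hUZ[].
exists [~ s, t].
  split; last exact: supportedR.
  by apply: (MR cZ) => //; exists z.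
move=> x Ux; rewrite commgEl conjgE !homeoM.
have -> : s^-1 x = g x by apply: (canLR (homeoKV s)); rewrite s2.
have [_ [nUgx nUhgx]] := gUW x Ux.
have -> : t^-1 (g x) = g x by apply: (canLR (homeoKV t)); rewrite t3.
by rewrite s2// t1.
Qed.

Lemma rist_compress_disjoint Q Y Z : clopen Q -> clopen Y -> clopen Z ->
  Q `<=` Z -> Y `<=` Z -> (forall x, Q x -> ~ Y x) ->
  (exists y, Y y) -> (exists z, ~ Z z) ->
  exists2 m, rist Z m & forall x, Q x -> Y (m x).
Proof.
move=> cQ cY cZ QZ YZ QY [y Yy] [z nZz].
(* The point [y'] left outside [C] provides the room that [rist_transport] requires. *)
have [C [y' [cC Cy CY Yy' nCy']]] := clopen_split cantorX (proj1 cY) Yy.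
have [||h Gh hQC] := flexible_clopen cQ cC.
- by exists z => /QZ.
- by exists y.
have [|||m Rm mh] := rist_transport Gh cQ cZ.
- move=> x Qx; have Yhx := CY _ (hQC _ Qx); split; [exact: QZ|exact: YZ|].
  by move=> /QY.
- by exists z.
- exists y'; split; [exact: YZ|by move=> /QY|].
  by move=> /hQC; rewrite homeoVKV.
by exists m => // x Qx; rewrite mh//; exact/CY/hQC.
Qed.

(** Aim at the part of [Y] outside [Q]; if there is none, pass first through the complement of [Q]
    in [Z]. *)
Lemma rist_compress Q Y Z : clopen Q -> clopen Y -> clopen Z ->
  Q `<=` Z -> Y `<=` Z -> (exists w, Z w /\ ~ Q w) ->
  (exists y, Y y) -> (exists z, ~ Z z) ->
  exists2 m, rist Z m & forall x, Q x -> Y (m x).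
Proof.
move=> cQ cY cZ QZ YZ [w [Zw nQw]] [y Yy] nZ.
have cZQ : clopen (Z `&` ~` Q) by apply: clopenI => //; exact: clopenC.
have [[v [Yv nQv]]|YQ] := pselect (exists v, Y v /\ ~ Q v).
  have [||||||||m Rm mQ] := @rist_compress_disjoint Q (Y `&` ~` Q) Z => //.
  - by apply: clopenI => //; exact: clopenC.
  - by move=> x [/YZ].
  - by move=> x Qx [_].
  - by exists v.
  by exists m => // x /mQ[].
have [||||m1 [Mm1 Zm1] mQ1] := @rist_compress_disjoint Q _ _ cQ cZQ cZ QZ => //.
- by move=> x Qx [_].
- by exists w.
have [|||||m2 [Mm2 Zm2] mQ2] := @rist_compress_disjoint _ Y _ cZQ cY cZ => //.
- by move=> x [Zx nQx] Yx; apply: YQ; exists x.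
- by exists y.
exists (m1 * m2); first by split; [exact: MM|exact: supportedM].
by move=> x /mQ1/mQ2.
Qed.

(** A strict compression: iterates of [m] never bring [q] back, so no positive power of [m] is
    trivial. *)
Lemma rist_dynamics O x : open O -> O x ->
  exists m Q Y q, [/\ rist O m, clopen Q /\ clopen Y, Y `<=` Q /\ Q `<=` O,
    Q q /\ ~ Y q & forall y, Q y -> Y (m y)].
Proof.
move=> oO Ox.
have [Z [z [cZ Zx ZO Oz nZz]]] := clopen_split cantorX oO Ox.
have [Q [w [cQ Qx QZ Zw nQw]]] := clopen_split cantorX (proj1 cZ) Zx.
have [Y [q [cY Yx YQ Qq nYq]]] := clopen_split cantorX (proj1 cQ) Qx.
have [||||m [Mm Zm] mQY] := @rist_compress Q Y Z cQ cY cZ QZ.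
- by move=> y /YQ/QZ.
- by exists w.
- by exists x.
- by exists z.
exists m, Q, Y, q; split=> //; first by split=> //; exact: supportedS Zm.
by split=> // y /QZ/ZO.
Qed.

Lemma rist_order12 O x : open O -> O x -> exists2 m, rist O m & m ^+ 12 <> 1.
Proof.
move=> oO Ox.
have [m [Q [Y [q [Rm _ [YQ _] [Qq nYq] mQY]]]]] := rist_dynamics oO Ox.
exists m => // m12; apply: nYq.
have mX n : Y ((m ^+ n.+1) q).
  by elim: n => [|n IHn]; [exact: mQY|rewrite expgSr homeoM; exact/mQY/YQ].
by have := mX 11; rewrite m12.
Qed.

Lemma rist_neq1 O x : open O -> O x -> exists2 m, rist O m & m <> 1.
Proof.
move=> oO Ox; have [m Rm m12] := rist_order12 oO Ox.
by exists m => // m1; apply: m12; rewrite m1 expg1n.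
Qed.

Lemma rist_moves O x : open O -> O x ->
  exists m y, [/\ rist O m, O y & m y <> y].
Proof.
move=> oO Ox; have [m [Mm Om] /homeo_neq1[y my]] := rist_neq1 oO Ox.
by exists m, y; split=> //; apply: contrapT => /Om.
Qed.

(** Take [m] compressing [Q] into [Y] and [k] supported in [Q] minus [Y]: [k] moves some [y] but
    fixes [m y]. *)
Lemma rist_noncommuting O x : open O -> O x ->
  exists f g, [/\ rist O f, rist O g & [~ f, g] <> 1].
Proof.
move=> oO Ox.
have [m [Q [Y [q [Rm [cQ cY] [YQ QO] [Qq nYq] mQY]]]]] := rist_dynamics oO Ox.
have cQY : clopen (Q `&` ~` Y) by apply: clopenI => //; exact: clopenC.
have [|k [y [[Mk QYk] [Qy nYy] ky]]] := @rist_moves (Q `&` ~` Y) q (proj1 cQY).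
  by [].
exists m, k; split=> //.
  by split=> //; apply: supportedS QYk => z [/QO].
move=> /eqP/commgP/(congr1 (fun h : homeo X => h y)); rewrite !homeoM.
rewrite QYk; first by move/homeo_inj => e; apply: ky.
by move=> [_]; apply; exact: mQY.
Qed.

(** * Algebraic disjointness and definability of rigid stabilizers *)

Lemma centralizing_rist h O : (forall k, rist O k -> commute h k) ->
  open O -> forall x, O x -> h x = x.
Proof.
move=> hO oO x Ox; apply: contrapT => hx.
have [C [cC Cx CO hC]] := clopen_displaced cantorX oO Ox hx.
have [k [y [[Mk Ck] Cy ky]]] := rist_moves (proj1 cC) Cx.
have : rist O k by split=> //; exact: supportedS Ck.
move=> /hO/(congr1 (fun u : homeo X => u y)); rewrite !homeoM.
by rewrite Ck; [move/homeo_inj => e; apply: ky|exact: hC].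
Qed.

Lemma disjoint_alg_disj f g : (forall x, f x <> x -> g x = x) -> alg_disj M f g.
Proof.
move=> fg h Mh nhf.
have [x hx fx] : exists2 x, h x <> x & f x <> x.
  apply: contrapT => nx; apply/nhf/commute_disjoint => x hx.
  by apply: contrapT => fx; apply: nx; exists x.
(* [C] consists of points moved by [f], where [g] is trivial, and [h] displaces it; so for [f1],
   [f2] supported in [C] the double commutator reduces to [[~ f1, f2]]. *)
have [C [cC Cx CD hC]] := clopen_displaced cantorX (open_moved cantorX f) fx hx.
have [f1 [f2 [[M1f C1] [M2f C2] f12]]] := rist_noncommuting (proj1 cC) Cx.
have gC : supported g (~` C) by move=> y /contrapT Cy; exact/fg/(CD _ Cy).
exists f1, f2; rewrite (commR_displaced hC C1 C2); split=> //.
- exact: commute_supported gC.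
- exact: commute_supported gC.
- by split=> //; apply: commute_supported gC; exact: supportedR.
Qed.

(* Five points of a [g]-orbit cannot be spread over the four sets
   [U, f1 U, f2 U, f2 (f1 U)], each of which meets every short [g]-orbit at most
   once. *)
Lemma alg_disj_expg12 f g x : M g -> alg_disj M f g -> f x <> x ->
  (g ^+ 12) x = x.
Proof.
move=> Mg fg fx; apply: contrapT => g12.
(* The exponent 12 is the least common multiple of 1, 2, 3 and 4, the possible differences between
   two of five consecutive exponents. *)
have gd d : d %| 12 -> (g ^+ d) x <> x.
  move=> /dvdnP[e e12] gdx; apply: g12; rewrite e12 mulnC expgnA.
  by elim: e {e12} => // e IHe; rewrite expgSr homeoM IHe.
have [C1 [cC1 C1x _ gC1]] := clopen_displaced cantorX openT I (gd 1%N isT).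
have [C2 [cC2 C2x C21 gC2]] :=
  clopen_displaced cantorX (proj1 cC1) C1x (gd 2 isT).
have [C3 [cC3 C3x C32 gC3]] :=
  clopen_displaced cantorX (proj1 cC2) C2x (gd 3 isT).
have [C4 [cC4 C4x C43 gC4]] :=
  clopen_displaced cantorX (proj1 cC3) C3x (gd 4 isT).
have [U [cU Ux U4 fU]] := clopen_displaced cantorX (proj1 cC4) C4x fx.
have gU d y : 0 < d < 5 -> U y -> ~ U ((g ^+ d) y).
  move=> d5 /U4 C4y /U4 C4gy; move: d d5 C4gy => [|[|[|[|[|//]]]]] // _ C4gy.
  - by apply: (gC1 y); [exact/C21/C32/C43|exact/C21/C32/C43].
  - by apply: (gC2 y); [exact/C32/C43|exact/C32/C43].
  - by apply: (gC3 y); [exact/C43|exact/C43].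
  - exact: (gC4 y).
have [h [y [[Mh Uh] Uy hy]]] := rist_moves (proj1 cU) Ux.
have nhf : ~ commute h f.
  move=> /(congr1 (fun u : homeo X => u y)); rewrite !homeoM.
  by rewrite (Uh (f y)) => [/homeo_inj|]; [exact: hy|exact: fU].
have [f1 [f2 [M1f M2f f1g f2g [c1 cg]]]] := fg h Mh nhf.
set c := [~ [~ h, f1], f2] in c1 cg.
(* The points moved by [c] lie in the four translates of [U] under the [p b], all of which commute
   with [g]. *)
pose p (b : bool * bool) := f1 ^+ b.1 * f2 ^+ b.2.
have pg b : commute (p b) g.
  apply/commute_sym/commuteM; apply/commuteX/commute_sym => //.
have cU' z : c z <> z -> exists b, U ((p b)^-1 z).
  move=> cz; apply: contrapT => /forallNP nU; apply: cz.
  pose V : set X := [set w | exists b : bool, U ((f1 ^+ b)^-1 w)].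
  have VU : U `<=` V by move=> w Uw; exists false; rewrite expgb invg1.
  have UhV : supported [~ h, f1] V.
    rewrite commgEl; apply: supportedM.
      by apply: supportedS VU _; exact: supportedV.
    by apply: supportedS (supportedJ Uh) => w Uw; exists true.
  rewrite /c commgEl homeoM (supportedV UhV); last first.
    move=> [b Ub]; apply: (nU (b, false)).
    by rewrite /p [X in _ * X]expgb mulg1.
  apply: (supportedJ UhV) => -[b Ub]; apply: (nU (b, true)).
  by rewrite /p invgM.
have [z cz] := homeo_neq1 c1.
have cgz i : c ((g ^+ i) z) <> (g ^+ i) z.
  have /(congr1 (fun u : homeo X => u z)) : commute (g ^+ i) c.
    by apply/commute_sym/commuteX.
  by rewrite !homeoM => -> /homeo_inj.
have /choice[b Ub] : forall i : 'I_5, exists b, U ((p b)^-1 ((g ^+ i) z)).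
  by move=> i; exact/cU'/cgz.
have lt_sep (i j : 'I_5) : i < j -> b i <> b j.
  move=> ij bij; have := Ub i; rewrite bij => Uj.
  have := gU (j - i) _ _ Uj; apply.
    by rewrite subn_gt0 ij /= (leq_ltn_trans (leq_subr _ _)).
  have pg' : commute (p (b j))^-1 (g ^+ (j - i)).
    exact/commuteX/commute_sym/commuteV/commute_sym.
  by rewrite -homeoM pg' homeoM -(homeoM (g ^+ i)) -expgnDr subnKC// ltnW.
have : injective b.
  move=> i j bij; apply: ord_inj.
  by case: (ltngtP i j) => // /lt_sep; rewrite bij.
by move=> /leq_card; rewrite card_ord card_prod card_bool.
Qed.

Definition moved (F : set (homeo X)) : set X :=
  [set x | exists2 f, F f & f x <> x].

(** If [k] moved a point outside the closure, it would displace a clopen set there that supports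
    some [g] in [M] with [g ^+ 12] nontrivial; this [g] is algebraically disjoint from [F], yet [k]
    does not commute with [g ^+ 12]. Conversely, [alg_disj_expg12] makes [g ^+ 12] trivial on the
    closure. *)
Lemma rstabE F : F `<=` M -> rstab M F = rist (closure (moved F)).
Proof.
move=> sFM; apply/seteqP; split=> [k [Mk Hk]|k [Mk kF]]; split=> //.
- move=> x nFx; apply: contrapT => kx.
  have oF : open (~` closure (moved F)).
    by rewrite openC; exact: closed_closure.
  have [C [cC Cx CF kC]] := clopen_displaced cantorX oF nFx kx.
  have [g [Mg gC] /homeo_neq1[y gy]] := rist_order12 (proj1 cC) Cx.
  have Cy : C y by apply: contrapT => nCy; exact/gy/(supportedX 12 gC).
  have : commute k (g ^+ 12).
    apply: Hk => // f Ff; apply: disjoint_alg_disj => z fz; apply: gC => Cz.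
    by apply: (CF z Cz); apply: subset_closure; exists f.
  move=> /(congr1 (fun h : homeo X => h y)); rewrite (homeoM k) (homeoM _ k).
  rewrite (supportedX 12 gC); last exact: kC.
  by move=> /homeo_inj /esym.
- move=> g Mg Hg; apply: commute_disjoint => x kx; apply: contrapT => gx.
  have Fx : closure (moved F) x by apply: contrapT => /kF.
  have [|y [[f Ff fy] gy]] := Fx [set y | (g ^+ 12) y <> y].
    by apply: open_nbhs_nbhs; split=> //; exact: open_moved.
  by apply: gy; exact: alg_disj_expg12 Mg (Hg _ Ff) fy.
Qed.

(** * Recovering open sets and gluing along them *)

Lemma rist_subM U : rist U `<=` M. Proof. by move=> k []. Qed.

Lemma rstab_rist U : clopen U -> rstab M (rist U) = rist U.
Proof.
move=> [oU cU]; rewrite rstabE; last exact: rist_subM.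
congr rist; apply/seteqP; split.
  suff: closure (moved (rist U)) `<=` closure U by rewrite -(closure_id U).1.
  by apply: closure_subset => x [k [_ kU] kx]; apply: contrapT => /kU.
move=> x Ux B; rewrite nbhsE => -[O [oO Ox] OB].
have [||k [y [[Mk kOU] [Oy Uy] ky]]] := @rist_moves (O `&` U) x.
- exact: openI.
- by [].
exists y; split; last exact: OB.
by exists k => //; split=> //; apply: supportedS kOU => z [].
Qed.

(* [region S] recovers an open set from the subgroup of the elements of [M] that
   it supports. *)
Definition region (S : set (homeo X)) : set X :=
  [set x | exists O, [/\ open O, O x & rist O `<=` S]].

Lemma open_region S : open (region S).
Proof.
rewrite openE => x [O [oO Ox OS]]; rewrite /interior /= nbhsE.
by exists O => // y Oy; exists O.
Qed.

Lemma rist_subset U V : U `<=` V -> rist U `<=` rist V.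
Proof. by move=> UV k [Mk kU]; split=> //; exact: supportedS kU. Qed.

Lemma ristJ U m : m \in G ->
  forall k, rist U k -> rist ((m^-1)%g @^-1` U) (k ^ m).
Proof. by move=> Gm k [Mk kU]; split; [exact: MJ|exact: supportedJ]. Qed.

Lemma not_region_rstab F x O : F `<=` M -> ~ region (rstab M F) x ->
  open O -> O x -> exists y, O y /\ ~ closure (moved F) y.
Proof.
move=> sFM nx oO Ox; apply: contrapT => nO; apply: nx.
exists O; split=> //; rewrite rstabE//; apply: rist_subset => y Oy.
by apply: contrapT => nFy; apply: nO; exists y.
Qed.

(** Suppose [x] lies in neither region. Some nontrivial [y] in [rstab M F1] is supported in a clopen
    set [V] missing [x]. The compressing [g] fixes [x], so near [x] there is room for a nontrivial
    [k] that centralizes [rstab M F0] and whose conjugate by [g] moves a point outside [V]; this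
    contradicts the compression. *)
Lemma covering_region F0 F1 : F0 `<=` M -> F1 `<=` M ->
  covering M (rstab M F0) (rstab M F1) ->
  forall x, region (rstab M F0) x \/ region (rstab M F1) x.
Proof.
move=> sF0 sF1 [[y1 [Sy1 /homeo_neq1[p y1p]]] Hcov] x.
apply: contrapT => /not_orP[nR0 nR1].
have oy1 := open_moved cantorX y1.
have y1F : [set z | y1 z <> z] `<=` closure (moved F1).
  move=> z y1z; apply: contrapT.
  by have : rstab M F1 y1 by []; rewrite rstabE// => -[_ +] => /[apply].
(* If the moved point [p] is [x] itself, its image is another moved point. *)
have [q [y1q qx]] : exists q, y1 q <> q /\ q <> x.
  have [px|] := pselect (p = x); last by move=> px; exists p.
  exists (y1 p); split; first by move=> /homeo_inj.
  by rewrite -px.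
have [_ _ _ zX] := cantorX.
have [V [cV Vq nVx]] := zX q x (introN eqP qx).
pose D := V `&` [set z | y1 z <> z].
have [||y [r [[My yD] _ yr]]] := @rist_moves D q.
- by apply: openI => //; case: cV.
- by [].
have Sy : rstab M F1 y.
  rewrite rstabE//; split=> //; apply: supportedS yD => z [_ /y1F]//.
have [|g [Sg Hg]] := Hcov _ Sy; first by move=> y1'; apply: yr; rewrite y1'.
move: Sg; rewrite rstabE// => -[Mg gF1].
have gx : g x = x.
  apply: contrapT => gx.
  have [z [gz nz]] := not_region_rstab sF1 nR1 (open_moved cantorX g) gx.
  by apply: gz; exact: gF1.
have oN : open (g @^-1` ~` V) by apply: open_homeo; have [] := clopenC V cV.
have Nx : (g @^-1` ~` V) x by rewrite /= gx.
have [z [Nz nz]] := not_region_rstab sF0 nR0 oN Nx.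
have oN' : open ((g @^-1` ~` V) `&` ~` closure (moved F0)).
  by apply: openI => //; rewrite openC; exact: closed_closure.
have [//|k [w [[Mk kN] [Nw nw] kw]]] := rist_moves oN' (x := z).
have : rstab M [set y] (k ^ g).
  apply: Hg => // r0; rewrite rstabE// => -[_ r0F].
  apply/commute_sym/commute_supported; first exact: r0F.
  by apply: supportedS kN => u [].
rewrite rstabE => [[_ kgy]|_ ->//].
have : (k ^ g) (g w) <> g w by rewrite homeoJ homeoKV => /homeo_inj.
apply; apply: kgy => clw.
have [|u [[_ -> yu] nVu]] := clw (~` V).
  by apply: open_nbhs_nbhs; split=> //; have [] := clopenC V cV.
by apply: yu; apply: yD => -[].
Qed.

Lemma region_conj S m x : m \in G -> (forall k, S k -> S (k ^ m)) ->
  region S x -> region S (m x).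
Proof.
move=> Gm SJ [O [oO Ox OS]]; exists ((m^-1)%g @^-1` O); split.
- exact: open_homeo.
- by rewrite /= homeoK.
- move=> k Rk; rewrite -(conjgKV m k); apply/SJ/OS.
  have := ristJ (gpredVr _ Gm) Rk; rewrite invgK.
  by apply: rist_subset => y /=; rewrite homeoK.
Qed.

Lemma subgroup_valJ : {morph (val : subgroup G -> homeo X) : x y / x ^ y}.
Proof. by apply: morphgJ => x y; exact: valM. Qed.

(** An automorphism is determined by its action on elements of small support. The element [g] glued
    from [m] and the identity conjugates those near any point as [b] does, which forces [b] to be
    conjugation by [g]. *)
Lemma region_glue (S0 S1 : set (homeo X)) (b : aut (subgroup G)) m :
  m \in G ->
  (forall x, region S0 x \/ region S1 x) ->
  (forall k, S0 k <-> S0 (k ^ m)) ->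
  (forall k : subgroup G, S1 (val k) -> b k = k) ->
  (forall k : subgroup G, S0 (val k) -> val (b k) = val k ^ m) ->
  exists g : subgroup G, b = inner g.
Proof.
move=> Gm cov SJ b1 b0.
have Sm k : S0 k -> S0 (k ^ m) by rewrite SJ.
have SmV k : S0 k -> S0 (k ^ m^-1) by rewrite (SJ (k ^ m^-1)) conjgKV.
have GmV : m^-1 \in G by exact: gpredVr.
have R0m x : region S0 x -> region S0 (m x) by exact: region_conj.
have R0mV x : region S0 x -> region S0 (m^-1 x) by exact: region_conj.
(* On the overlap [b] both fixes the elements of the rigid stabilizer and conjugates them by [m], so
   [m] centralizes it and the two pieces are compatible. *)
have m_id x : region S0 x -> region S1 x -> m x = x.
  move=> [O0 [oO0 O0x OS0]] [O1 [oO1 O1x OS1]].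
  have := @centralizing_rist m (O0 `&` O1); apply; [|exact: openI|by []].
  move=> k Rk; have Gk := MG (rist_subM Rk).
  have S0k : S0 k by apply: OS0; apply: rist_subset Rk => y [].
  have S1k : S1 k by apply: OS1; apply: rist_subset Rk => y [].
  apply/commute_sym/commute_conj1.
  by have := b0 (Sub k Gk) S0k; rewrite (b1 (Sub k Gk) S1k) => <-.
pose u x := if pselect (region S0 x) then m x else x.
pose v x := if pselect (region S0 x) then m^-1 x else x.
have u0 x : region S0 x -> u x = m x by rewrite /u; case: pselect.
have u1 x : region S1 x -> u x = x.
  by rewrite /u; case: pselect => // R0 R1; exact: m_id.
have v0 x : region S0 x -> v x = m^-1 x by rewrite /v; case: pselect.
have v1 x : region S1 x -> v x = x.
  rewrite /v; case: pselect => // R0 R1; apply: (canLR (homeoKV m)).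
  by rewrite m_id.
have uK : cancel u v.
  move=> x; rewrite {1}/u; case: pselect => R0 /=.
    by rewrite v0 ?homeoKV//; exact: R0m.
  by rewrite /v; case: pselect.
have vK : cancel v u.
  move=> x; rewrite {1}/v; case: pselect => R0 /=.
    by rewrite u0 ?homeoVKV//; exact: R0mV.
  by rewrite /u; case: pselect.
have lu : agrees_locally u.
  move=> x; have [R0|R1] := cov x.
    by exists (region S0), m; split=> //; exact: open_region.
  exists (region S1), 1; split=> //; [exact: open_region|exact: gpred1].
have lv : agrees_locally v.
  move=> x; have [R0|R1] := cov x.
    by exists (region S0), m^-1; split=> //; exact: open_region.
  exists (region S1), 1; split=> //; [exact: open_region|exact: gpred1].
have [g Gg gu] := full_glue uK vK lu lv.
pose g' : subgroup G := Sub g Gg.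
have bg x : exists O, [/\ open O, O x &
    forall k : subgroup G, rist O (val k) -> b k = k ^ g'].
  have [[O [oO Ox OS]]|[O [oO Ox OS]]] := cov x; exists O; split=> // k Rk.
  - apply: val_inj; rewrite b0; last exact: OS.
    apply: (conjg_supported (U := O)); first by case: Rk.
    by move=> z Oz; rewrite gu u0//; exists O.
  - rewrite b1; last exact: OS.
    apply: val_inj; rewrite -[LHS]conjg1.
    apply: (conjg_supported (U := O)); first by case: Rk.
    by move=> z Oz; rewrite gu u1//; exists O.
exists g'; apply: autP => q.
have qg x : g (val q x) = val (b q) (g x).
  have [O1 [oO1 O1x b1g]] := bg x; have [O2 [oO2 O2x b2g]] := bg (val q x).
  (* For [k] of small support, computing [b (k ^ q)] in two ways shows that [w] centralizes [k]. *)
  pose w := val q * g * (val (b q))^-1 * g^-1.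
  have wO : forall y, (O1 `&` (val q : homeo X) @^-1` O2) y -> w y = y.
    apply: centralizing_rist; last by apply: openI => //; exact: open_homeo.
    move=> k Rk; have Gk := MG (rist_subM Rk); pose k' : subgroup G := Sub k Gk.
    have R1 : rist O1 (val k') by apply: rist_subset Rk => y [].
    have R2 : rist O2 (val (k' ^ q)).
      rewrite subgroup_valJ.
      apply: rist_subset (ristJ (valP q) Rk) => y [_] /=.
      by rewrite homeoVKV.
    apply/commute_sym/commute_conj1; rewrite /w !conjgM.
    have := b2g _ R2; rewrite (morphgJ (@autM _ b)) b1g// => /(congr1 val) e.
    rewrite !subgroup_valJ !SubK in e.
    by rewrite -e !conjgK.
  have := wO x (conj O1x O2x); rewrite /w !homeoM => e.
  by rewrite -[in RHS]e !homeoVKV.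
apply: val_inj; apply: homeoP => x.
by rewrite -[in LHS](homeoVKV g x) -qg.
Qed.

(** * Elements of [G] satisfy the formula *)

Lemma full_agrees_somewhere (x0 : X) g : g \in G -> exists m U,
  [/\ M m, clopen U, exists x, U x, exists z, ~ U z &
      forall x, U x -> g x = m x].
Proof.
move=> Gg; have [->|/eqP/homeo_neq1[x gx]] := eqVneq g 1.
  have [U [z [cU Ux _ _ nUz]]] := clopen_split cantorX openT (I : setT x0).
  by exists 1, U; split=> //; [exists x0|exists z].
have [C [cC Cx _ gC]] := clopen_displaced cantorX openT I gx.
have [U [y [cU Ux UC Cy nUy]]] := clopen_split cantorX (proj1 cC) Cx.
have oCU : open (C `&` ~` U).
  by apply: openI; [case: cC|have [] := clopenC U cU].
(* Removing [D] makes the set to work in proper. The point [z] of [C] outside [U] and [D] is the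
   free room, since [C] is disjoint from its image under [g]. *)
have [D [z [cD Dy DCU [Cz nUz] nDz]]] := clopen_split cantorX oCU (conj Cy nUy).
have [|||m [Mm _] mg] := @rist_transport g U (~` D) Gg cU (clopenC D cD).
- move=> u Uu; split; first by move=> /DCU[].
    by move=> /DCU[Cgu _]; exact: gC (UC _ Uu) Cgu.
  by move=> /UC; exact/gC/UC.
- by exists y; apply; exact: Dy.
- exists z; split=> // Ugz; apply: (gC _ (UC _ Ugz)).
  by rewrite homeoVKV.
exists m, U; split=> //; [by exists x|by exists y|by move=> u /mg].
Qed.

(** Dividing by [m] leaves [e], the identity on [U], which serves as [V]. Taking for [W] the
    complement of a smaller clopen set [Q] makes [W] and [U] cover the space. *)
Lemma full_loc_inner (x0 : X) g : g \in G -> loc_inner M g.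
Proof.
move=> Gg.
have [m [U [Mm cU [x Ux] [z nUz] gm]]] := full_agrees_somewhere x0 Gg.
pose e := g * m^-1.
have Ge : e \in G by apply: gpredM => //; exact/gpredVr/MG.
have eU x' : U x' -> e x' = x' by move=> U'; rewrite homeoM gm// homeoKV.
have [Q [p [cQ Qx QU Up nQp]]] := clopen_split cantorX (proj1 cU) Ux.
have [Q' [q [cQ' Q'x Q'Q Qq nQ'q]]] := clopen_split cantorX (proj1 cQ) Qx.
pose W := ~` Q; have cW : clopen W by exact: clopenC.
have [||h Gh hW] := flexible_clopen cW cQ'.
- by exists x => nQx; exact: nQx.
- by exists x.
have [|s Gs [s1 s2 s3]] := full_swap Gh cW.
  by move=> y /hW/Q'Q Qhy; apply.
have eW : supported e W by move=> y /contrapT/QU/eU.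
(* [m'] is [e] times a conjugate of [e^-1] that lives in [Q'], so it agrees with [e] on [W]; as a
   commutator of elements supported in a common proper clopen set it belongs to [M]. *)
pose m' := [~ e^-1, s].
have cWQ : clopen (W `|` Q') by exact: clopenU.
have Mm' : M m'.
  apply: (MR cWQ).
  - by exists q => -[|//]; apply.
  - exact: gpredVr.
  - by [].
  - by apply: supportedS (supportedV eW) => y; left.
  - move=> y /not_orP[nW nQ']; apply: s3 => // /hW.
    by rewrite homeoVKV.
have Gm' := MG Mm'.
have m'W y : W y -> m' y = e y.
  move=> Wy; have We : W (e y) by exact: supported_stable eW Wy.
  rewrite /m' commgEl conjgE invgK !homeoM.
  have -> : s^-1 (e y) = h (e y) by apply: (canLR (homeoKV s)); rewrite s2.
  have -> : e^-1 (h (e y)) = h (e y).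
    by apply: (canLR (homeoKV e)); rewrite (eU (h _))//; exact/QU/Q'Q/hW.
  exact: s2.
have W_m' y : W (m' y) <-> W y.
  split=> [Wm|Wy]; last by rewrite m'W//; exact: supported_stable eW Wy.
  have WeV : W (e^-1 (m' y)) by exact: supported_stable (supportedV eW) Wm.
  suff -> : y = e^-1 (m' y) by [].
  by apply: (@homeo_inj _ m'); rewrite (m'W _ WeV) homeoVKV.
exists m, m', (rist W), (rist U); split=> //; try exact: rist_subM.
rewrite !rstab_rist//; split.
- split; first by have [k Rk k1] := rist_neq1 (proj1 cU) Ux; exists k.
  move=> y [My yU] /homeo_neq1[v yv].
  have [Y [cY Yv Yy]] := clopen_base cantorX (open_moved cantorX y) yv.
  (* An element centralizing the rigid stabilizer of [W] lives in [Q], so it is enough that [r]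
     compresses [Q] into the points moved by [y]. *)
  have [||||r Rr rQ] := @rist_compress Q Y U cQ cY cU QU.
  + by move=> w /Yy yw; apply: contrapT => /yU.
  + by exists p.
  + by exists v.
  + by exists z.
  exists r; split=> // k Mk kW.
  rewrite rstabE; last by move=> _ ->.
  split; first by apply: MJ => //; exact/MG/(rist_subM Rr).
  have kQ : supported k Q.
    by move=> w nQw; exact: (centralizing_rist kW (proj1 cW)).
  apply: supportedS (supportedJ kQ) => w /= /rQ; rewrite homeoVKV => /Yy yw.
  by apply: subset_closure; exists y.
- move=> k [_ kU]; apply/commute_sym/(commute_supported kU) => w /contrapT.
  exact: eU.
- move=> k [_ kW]; apply/commute_sym/(commute_supported kW) => w /contrapT Ww.
  by rewrite homeoM -m'W// homeoKV.
- move=> k; split=> [/(ristJ Gm')|].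
    by apply: rist_subset => y /=; rewrite -W_m' homeoVKV.
  move=> /(ristJ (gpredVr _ Gm')); rewrite conjgK invgK.
  by apply: rist_subset => y /= /W_m'.
Qed.

Lemma rist_centerless h : (forall k, M k -> commute h k) -> h = 1.
Proof.
move=> hM; apply: homeoP => x.
by rewrite (@centralizing_rist h setT _ openT)// => k [/hM].
Qed.

End FullFlexible.

(** * Burnside's criterion for completeness of the automorphism group *)

Section Automorphisms.
Variable H : groupType.
Implicit Types (a : aut H) (g h : H).

Lemma aut_injective a : injective a. Proof. exact: can_inj (autK a). Qed.

Lemma innerM : {morph @inner H : g h / g * h}.
Proof. by move=> g h; apply: autP => x; exact: conjgM. Qed.

Lemma innerJ g a : inner g ^ a = inner (a g).
Proof.
apply: autP => x; have -> : (inner g ^ a) x = a (a^-1 x ^ g) by [].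
by rewrite (morphgJ (@autM _ a)); congr (_ ^ _); exact: autVK.
Qed.

Definition centerless := forall h, (forall g, commute h g) -> h = 1.

Hypothesis ctrH : centerless.

Lemma inner_inj : injective (@inner H).
Proof.
move=> g h gh; rewrite -[LHS](mulgVK h) (_ : g / h = 1) ?mul1g//.
apply: ctrH => x; apply/commute_sym/commute_conj1.
have e : x ^ g = x ^ h by exact: (congr1 (fun a : aut H => a x) gh).
by rewrite conjgM e conjgK.
Qed.

(** Through the inner automorphisms [phi] induces an automorphism [c] of [H]; and [phi] is
    conjugation by [c], because an automorphism is determined by how it conjugates inner
    automorphisms. *)
Lemma aut_complete :
  (forall (phi : aut (aut H)) g, exists h, phi (inner g) = inner h) ->
  bijective (@inner (aut H)).
Proof.
move=> char.
have inj : injective (@inner (aut H)).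
  move=> a b ab; apply: autP => g; apply: inner_inj; rewrite -!innerJ.
  exact: (congr1 (fun c : aut (aut H) => c (inner g)) ab).
have surj (phi : aut (aut H)) : exists a, inner a = phi.
  have [u phiu] := choice (char phi).
  have [v phiVv] := choice (char phi^-1).
  have uK : cancel u v.
    by move=> g; apply: inner_inj; rewrite -phiVv -phiu; exact: autK.
  have vK : cancel v u.
    by move=> g; apply: inner_inj; rewrite -phiu -phiVv; exact: autVK.
  have uM : {morph u : g h / g * h}.
    by move=> g h; apply: inner_inj; rewrite -phiu !innerM autM !phiu.
  pose c := AutOf uK vK uM; exists c; apply: autP => a.
  rewrite -[RHS](mulKg c) -[LHS]/(c^-1 * (a * c)); congr (_ * _).
  apply: autP => g; apply: inner_inj.
  have cE h : inner (c h) = phi (inner h) by rewrite phiu.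
  have -> : (a * c) g = c (a g) by [].
  have -> : (c * phi a) g = phi a (c g) by [].
  by rewrite cE -(innerJ g a) -(innerJ (c g)) cE (morphgJ (@autM _ phi)).
have [f fK] := choice surj.
by exists f => [a|//]; apply: inj.
Qed.

End Automorphisms.

(** * The intersection of the nontrivial normal subgroups *)

Section Core.
Variable T : groupType.

Definition normal_subgroup (N : set T) := [/\ N 1,
  forall x y, N x -> N y -> N (x * y), forall x, N x -> N x^-1 &
  forall x y, N x -> N (x ^ y)].

Definition core : set T := [set x | forall N, normal_subgroup N ->
  (exists2 y, N y & y <> 1) -> N x].

End Core.

Arguments core : clear implicits.

Section CoreTheory.
Variable T : groupType.

Lemma normal_core : normal_subgroup (core T).
Proof.
split=> [N [N1 _ _ _] _ //|x y cx cy|x cx|x y cx] N nN ntN;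
  have [_ NM NV NJ] := nN.
- by apply: NM; [exact: cx|exact: cy].
- by apply: NV; exact: cx.
- by apply: NJ; exact: cx.
Qed.

(** The preimage under [phi] of a nontrivial normal subgroup is another one. *)
Lemma core_aut (phi : aut T) x : core T x -> core T (phi x).
Proof.
move=> cx N [N1 NM NV NJ] [y Ny y1].
have phiM := @autM _ phi.
apply: (cx (phi @^-1` N)).
  split=> /= [|u v Nu Nv|u Nu|u v Nu].
  - by rewrite (morphg1 phiM).
  - by rewrite phiM; exact: NM.
  - by rewrite (morphgV phiM); exact: NV.
  - by rewrite (morphgJ phiM); exact: NJ.
exists (phi^-1 y) => /=; first by rewrite (autVK phi).
by move=> /(congr1 phi); rewrite (autVK phi) (morphg1 phiM).
Qed.

Lemma image_core (phi : aut T) : phi @` core T = core T.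
Proof.
apply/seteqP; split=> [_ [x cx <-]|x cx]; first exact: core_aut.
by exists (phi^-1 x); [exact: core_aut|exact: autVK].
Qed.

End CoreTheory.

(** * The core of Aut(G) and the characterization of inner automorphisms *)

Section Main.
Variable G : groupClosed (homeo cantor_space).
Hypotheses (fullG : full G) (flexG : flexible G).
Local Notation X := cantor_space.
Local Notation H := (subgroup G).
Let cantorX := cantor_like_cantor_space.

Let G_M f g : f \in G -> g \in G -> f * g \in G. Proof. exact: gpredM. Qed.
Let G_R (E : set X) f g : clopen E -> (exists x, ~ E x) ->
  f \in G -> g \in G -> supported f E -> supported g E -> [~ f, g] \in G.
Proof. by move=> _ _ Gf Gg _ _; exact: gpredR. Qed.

Lemma full_flexible_centerless : centerless H.
Proof.
move=> h hH; apply: val_inj.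
apply: (rist_centerless cantorX fullG flexG (M := [set g | g \in G])) => //.
move=> k Gk; exact: (congr1 val (hH (Sub k Gk))).
Qed.

Let valM' : {morph (val : H -> homeo X) : f g / f * g}.
Proof. by move=> f g; exact: valM. Qed.

Lemma normal_subgroupR (T : groupType) (N : set T) x y :
  normal_subgroup N -> N x -> N [~ x, y].
Proof.
by move=> [_ NM NV NJ] Nx; rewrite commgEl; apply: NM; [exact: NV|exact: NJ].
Qed.

(** A nontrivial [a] in [N] yields the nontrivial inner automorphism [[~ a, inner g0]], induced by
    [n]. Conjugated into a set displaced by [n], the commutator [[~ f, g]] becomes by Higman's trick
    a double commutator starting with [n], and normality applies. *)
Lemma normal_subgroup_commR (N : set (aut H)) : normal_subgroup N ->
  (exists2 a, N a & a <> 1) -> forall (E : set X) (f g : H),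
  clopen E -> (exists x, ~ E x) -> supported (val f) E -> supported (val g) E ->
  N (inner [~ f, g]).
Proof.
move=> nN [a Na a1] E f g cE nE fE gE.
have [g0 ag0] : exists g0, a g0 <> g0.
  apply: contrapT => /forallNP na; apply/a1/autP => x; exact: contrapT (na x).
pose n := a g0^-1 * g0.
have Nn : N (inner n).
  suff -> : inner n = [~ a, inner g0] by exact: normal_subgroupR.
  by rewrite commgEr innerM -innerJ (morphgV (@innerM _)).
have [x nx] : exists x, val n x <> x.
  apply: homeo_neq1 => n1; apply: ag0.
  have /mulg1_eq n1' : n = 1 by exact: val_inj.
  by rewrite -[RHS]n1' (morphgV (@autM _ a)) invgK.
have [U [cU Ux _ nU]] := clopen_displaced cantorX openT I nx.
have [|h Gh hEU] := flexible_clopen cantorX flexG cE cU nE; first by exists x.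
pose h' : H := Sub h Gh.
have J_U (k : H) : supported (val k) E -> supported (val (k ^ h')) U.
  move=> kE; rewrite (morphgJ valM') SubK.
  by apply: supportedS (supportedJ kE) => y /= /hEU; rewrite homeoVK.
have e : [~ [~ n, f ^ h'], g ^ h'] = [~ f, g] ^ h'.
  apply: val_inj; rewrite conjRg !(morphgR valM').
  by apply: (commR_displaced nU); exact: J_U.
have [_ _ _ NJ] := nN.
rewrite -(conjgK (inner h') (inner _)); apply: NJ.
rewrite -(morphgJ (@innerM _)) -e !(morphgR (@innerM _)).
by do 2 apply: normal_subgroupR => //.
Qed.

Lemma nontrivial_subgroup : exists g : H, g <> 1.
Proof.
have [m [Gm _] m1] := rist_neq1 cantorX fullG flexG (M := [set g | g \in G])
  G_M G_R openT (I : setT point).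
exists (Sub m Gm) => /(congr1 val); rewrite SubK => e; exact: m1.
Qed.

(** The inner automorphisms are among the nontrivial normal subgroups being intersected. *)
Lemma core_inner : core (aut H) `<=` range (@inner H).
Proof.
have innerV := morphgV (@innerM H).
move=> a; apply.
  split=> [|_ _ [f _ <-] [g _ <-]|_ [f _ <-]|_ b [f _ <-]].
  - by exists 1 => //; exact: (morphg1 (@innerM H)).
  - by exists (f * g); rewrite ?innerM.
  - by exists f^-1; rewrite ?innerV.
  - by exists (b f); rewrite ?innerJ.
have [g g1] := nontrivial_subgroup.
exists (inner g) => // e; apply/g1/(inner_inj full_flexible_centerless).
by rewrite e (morphg1 (@innerM H)).
Qed.

(** The core appears in three guises: as automorphisms, as the elements [MH] of [H], and as the
    homeomorphisms [M]. Formulas pass between them along [inner] and [val]. *)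
Let MH : set H := @inner H @^-1` core (aut H).
Let M : set (homeo X) := val @` MH.

Lemma inner_MH : @inner H @` MH = core (aut H).
Proof.
apply/seteqP; split=> [_ [g cg <-]//|a ca].
by have [g _ ga] := core_inner ca; exists g; rewrite // /MH /= ga.
Qed.

Let MG f : M f -> f \in G. Proof. by move=> [g _ <-]; exact: valP. Qed.

Let M1 : M 1.
Proof.
have [c1 _ _ _] := normal_core (aut H).
exists 1; first by rewrite /MH /= (morphg1 (@innerM H)).
exact: (morphg1 valM').
Qed.

Let MM f g : M f -> M g -> M (f * g).
Proof.
have [_ cM _ _] := normal_core (aut H).
move=> [f' cf <-] [g' cg <-]; exists (f' * g'); last exact: valM'.
by rewrite /MH /= innerM; exact: cM.
Qed.

Let MJ f g : M f -> g \in G -> M (f ^ g).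
Proof.
have [_ _ _ cJ] := normal_core (aut H).
move=> [f' cf <-] Gg; exists (f' ^ Sub g Gg); last first.
  by rewrite (morphgJ valM') SubK.
by rewrite /MH /= (morphgJ (@innerM H)); exact: cJ.
Qed.

Let MR (E : set X) f g : clopen E -> (exists x, ~ E x) ->
  f \in G -> g \in G -> supported f E -> supported g E -> M [~ f, g].
Proof.
move=> cE nE Gf Gg fE gE; exists [~ Sub f Gf, Sub g Gg]; last first.
  by rewrite (morphgR valM') !SubK.
move=> N nN ntN; apply: (normal_subgroup_commR nN ntN cE nE).
  by rewrite SubK.
by rewrite SubK.
Qed.

Lemma loc_inner_inner (g : H) : loc_inner (core (aut H)) (inner g).
Proof.
rewrite -inner_MH (loc_inner_morph _ (@innerM H)); last first.
  exact/inner_inj/full_flexible_centerless.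
rewrite -(loc_inner_morph MH valM' val_inj).
exact: (full_loc_inner cantorX fullG flexG MG M1 MM MJ MR point (valP g)).
Qed.

(** Read in the group of homeomorphisms, the formula supplies the hypotheses of [region_glue] for
    [b], the quotient of [a] by [inner m]; so [b] is inner, and with it [a]. *)
Lemma inner_loc_inner (a : aut H) : loc_inner (core (aut H)) a ->
  exists g, a = inner g.
Proof.
have inj_inner := inner_inj full_flexible_centerless.
rewrite -inner_MH => -[_ [_ [F0 [F1 [[m _ <-] [m' _ <-]]]]]].
move=> /sub_imageP[{}F0 -> sF0] /sub_imageP[{}F1 -> sF1].
rewrite !(rstab_morph _ (@innerM H))// (covering_morph _ (@innerM H))//.
set b := a * _ => -[cov b1 b0 bJ].
have sF (F : set H) : F `<=` MH -> val @` F `<=` M by exact: image_subset.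
have covX : forall x, region M (val @` rstab MH F0) x \/
    region M (val @` rstab MH F1) x.
  rewrite -!(rstab_morph _ valM' val_inj).
  apply: (covering_region cantorX fullG flexG MM MR (sF _ sF0) (sF _ sF1)).
  rewrite !(rstab_morph _ valM' val_inj).
  by rewrite (covering_morph _ valM' val_inj).
have inner_im (F : set H) g : (@inner H @` F) (inner g) = F g.
  exact: image_morph.
have val_im (F : set H) (g : H) : (val @` F) (val g) = F g.
  exact: (image_morph val_inj).
have commute_inner (c : aut H) (k : H) : commute c (inner k) -> c k = k.
  by move=> /commute_sym/commute_conj1; rewrite innerJ; exact: inj_inner.
have [k|k|k|g bg] := region_glue cantorX fullG flexG MG MM MJ MR
    (S0 := val @` rstab MH F0) (b := b) (valP m') covX.
- have J l : rstab MH F0 l <-> rstab MH F0 (l ^ m').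
    by rewrite -inner_im bJ -(morphgJ (@innerM H)) inner_im.
  split=> [[l Fl <-]|[l Fl lk]].
    by rewrite -(morphgJ valM') val_im -J.
  have -> : k = val (l ^ m'^-1).
    by rewrite (morphgJ valM') lk (morphgV valM') conjgK.
  by rewrite val_im J conjgKV.
- by rewrite val_im => Fk; apply/commute_inner/b1; rewrite inner_im.
- rewrite val_im => Fk; rewrite -(morphgJ valM'); congr val.
  have : (b k) ^ m'^-1 = k.
    by apply/(commute_inner (b / inner m'))/b0; rewrite inner_im.
  by move=> /(congr1 (conjg^~ m')); rewrite conjgKV.
by exists (g * m); rewrite innerM -bg mulgVK.
Qed.

End Main.

Theorem theorem1p1 (G : groupClosed (homeo cantor_space))
    (fullG : full G) (flexG : flexible G) :
  {morph @inner (aut (subgroup G)) : a b / (a * b)%g} /\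
  bijective (@inner (aut (subgroup G))).
Proof.
split; first exact: innerM.
apply: aut_complete => [|phi g]; first exact: full_flexible_centerless.
apply: inner_loc_inner => //.
(* [phi] preserves the core, so [phi (inner g)] satisfies the formula as soon as [inner g] does. *)
rewrite -(image_core phi) (loc_inner_morph _ (@autM _ phi)) //.
  exact: loc_inner_inner.
exact: aut_injective.
Qed.
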